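(* The factor $m^{1/2}$ in the inequality $\sigma_m(K,\mathcal{LK}(\infty))_\infty \le Bm^{1/2}\sigma_{\theta(m-1)}(K,\Pi(\infty))_\infty$ (valid, for every $b\in(1,2]$, with $B=B(b)$ for all continuous $K$ on products of compact sets, where $\theta=1/b$ in the real case and $\theta=1/(2b)$ in the complex case) is sharp in order. That is: let $b\in(1,2]$, let $\theta=1/b$ in the real case and $\theta=1/(2b)$ in the complex case, and suppose that $(\varphi(m))_{m\ge1}$ is a sequence of positive numbers such that $$ \sigma_m(K,\mathcal{LK}(\infty))_\infty \le \varphi(m)\,\sigma_{\theta(m-1)}(K,\Pi(\infty))_\infty $$ for all $m\in\mathbb N$, all compact $\Omega^1,\Omega^2$ and all continuous functions $K$ on $\Omega^1\times\Omega^2$. Then there is a constant $c>0$ such that $\varphi(m)\ge c\,m^{1/2}$ for all $m\in\mathbb N$.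
   Context: $\|\cdot\|_\infty$ denotes the uniform (supremum) norm, and $L_\infty(\Omega)$ is understood as the space of continuous functions on $\Omega$ with this norm. Real case: all functions and coefficients are real-valued; complex case: complex-valued. Compact sets may be taken as compact subsets of Euclidean spaces (for instance the circle $\mathbb T$, i.e. $[0,2\pi)$ with endpoints identified). For a system $\mathcal D$ of functions on $\Omega^1\times\Omega^2$, $\sigma_m(K,\mathcal D)_\infty := \inf \|K-\sum_{i=1}^m c_i g_i\|_\infty$, the infimum being over scalars $c_i$ and $g_i\in\mathcal D$ ($\sigma_0(K,\mathcal D)_\infty=\|K\|_\infty$). For real $s\ge0$, $\sigma_s$ means $\sigma_{\lfloor s\rfloor}$. $\Pi(\infty)$ is the set of all functions $u(\mathbf x)v(\mathbf y)$ with $u\in L_\infty(\Omega^1)$, $v\in L_\infty(\Omega^2)$. $\mathcal{LK}(\infty)$ (which depends on $K$) is the set of all functions of the form $u(\mathbf x)K(\mathbf z,\mathbf y)$ with $\mathbf z\in\Omega^1$ and $u\in L_\infty(\Omega^1)$. *)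

(* Defs.v *)
From HB Require Import structures.
From mathcomp Require Import all_boot all_order all_algebra.
From mathcomp Require Import complex.
From mathcomp Require Import all_classical all_reals all_analysis.
Set Implicit Arguments.
Unset Strict Implicit.
Unset Printing Implicit Defensive.
Import Order.TTheory GRing.Theory Num.Theory.
Import numFieldNormedType.Exports.
Local Open Scope classical_set_scope.
Local Open Scope ring_scope.

(* The scalar field F is R or R[i]. As the norm of R[i] takes its values in
   R[i], the absolute value is passed separately as a map into R. *)
Definition real_abs (R : realType) (x : R) : R := `|x|.
Definition complex_abs (R : realType) (z : R[i]) : R := complex.Re `|z|.

(* Functions on A are represented by total functions on the ambient type, of
   which only the values on A matter. *)
Definition Linfty (F : numFieldType) (T : topologicalType) (A : set T) :
    set (T -> F) :=
  [set u | {within A, continuous u}].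

Section approximation.
Variables (R : realType) (F : numFieldType) (abs : F -> R).

(* Used only for A nonempty and compact and f continuous on A, in which case
   the supremum is that of a nonempty bounded set. *)
Definition supnorm (T : Type) (A : set T) (f : T -> F) : R :=
  sup [set abs (f t) | t in A].

Definition sigma (T : Type) (A : set T) (m : nat) (f : T -> F)
    (D : set (T -> F)) : R :=
  inf [set e | exists (c : 'I_m -> F) (g : 'I_m -> T -> F),
    (forall i, D (g i)) /\
    e = supnorm A (fun t => f t - \sum_(i < m) c i * g i t)].

(* Order of approximation s real, s >= 0. *)
Definition sigma_real (T : Type) (A : set T) (s : R) (f : T -> F)
    (D : set (T -> F)) : R :=
  sigma A (Num.truncn s) f D.

Definition Pi_infty (T1 T2 : topologicalType) (A1 : set T1) (A2 : set T2) :
    set (T1 * T2 -> F) :=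
  [set g | exists (u : T1 -> F) (v : T2 -> F),
    [/\ Linfty A1 u, Linfty A2 v & g = fun p => u p.1 * v p.2]].

Definition LK_infty (T1 T2 : topologicalType) (A1 : set T1)
    (K : T1 * T2 -> F) : set (T1 * T2 -> F) :=
  [set g | exists (z : T1) (u : T1 -> F),
    [/\ A1 z, Linfty A1 u & g = fun p => u p.1 * K (z, p.2)]].

(* Compact sets range over nonempty compact subsets of Euclidean spaces; the
   norm-induced topology on 'rV[R]_d is the Euclidean one. *)
Definition LK_bound (theta : R) (phi : nat -> R) : Prop :=
  forall (m d1 d2 : nat) (A1 : set 'rV[R]_d1) (A2 : set 'rV[R]_d2)
    (K : 'rV[R]_d1 * 'rV[R]_d2 -> F),
  (0 < m)%N ->
  compact A1 -> A1 !=set0 -> compact A2 -> A2 !=set0 ->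
  Linfty (A1 `*` A2) K ->
  sigma (A1 `*` A2) m K (LK_infty A1 K) <=
  phi m * sigma_real (A1 `*` A2) (theta * (m.-1)%:R) K (Pi_infty A1 A2).

End approximation.

(* Main.v *)
Require Import Defs.
From mathcomp Require Import all_boot all_order all_algebra.
From mathcomp Require Import complex finfield.
From mathcomp Require Import all_classical all_reals all_analysis.
From mathcomp Require Import lra zify.
Import Order.TTheory GRing.Theory Num.Theory.
Import numFieldNormedType.Exports.
Local Open Scope ring_scope.

(** The kernel K = q * delta, where delta is the N x N identity matrix seen as
    a function on the square of a set of N points of the line, separates the
    two kinds of approximation.  A combination of m < N rows of K vanishes on
    the diagonal entry of every row that was not selected, so m rows leave an
    error of at least q ([sigma_LK_diag_ge]).  Approximants of low rank do much
    better: if S_x, for x among the N points, are q-element subsets of a set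
    with k elements which pairwise meet in at most t points, then the matrix
    #|S_x :&: S_y| has rank at most k, equals K on the diagonal, and is at most
    t off the diagonal ([sigma_Pi_diag_le]).  Hence q <= phi(m) * t whenever
    m < N and k = floor(theta (m-1)).

    The set system consists of the graphs of the polynomials of degree at most
    two over a field with q elements: these are q^3 subsets of a plane of q^2
    points, and two of them meet in at most t = 2 points because a nonzero
    quadratic has at most two roots.  Since theta >= 1/4 for 1 < b <= 2, in
    the real and in the complex case, q may be the largest power of 2 with
    4 q^2 <= m - 1.  Then m <= 16 q^2, and once m > 4^6, so that q >= 32, it
    follows that m < q^3 and phi(m) >= q / 2 >= sqrt(m) / 8
    ([LK_bound_large]).  The finitely many remaining m only affect the constant,
    because phi(m) > 0. *)

(** * Graphs of polynomials over a finite field *)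

(** The graph of a polynomial function, as a subset of the affine plane. *)
Definition poly_graph (F : finFieldType) (p : {poly F}) : {set F * F} :=
  [set (x, p.[x]) | x in F].

Lemma card_poly_graph (F : finFieldType) (p : {poly F}) :
  #|poly_graph F p| = #|F|.
Proof. by rewrite card_imset // => x y []. Qed.

Lemma card_poly_graphI (F : finFieldType) (n : nat) (p q : {poly F}) :
  (size p <= n)%N -> (size q <= n)%N -> p != q ->
  (#|poly_graph F p :&: poly_graph F q| < n)%N.
Proof.
move=> sp sq pq; have pq0 : p - q != 0 by rewrite subr_eq0.
pose r := [set x | root (p - q) x].
have sub : poly_graph F p :&: poly_graph F q \subset [set (x, p.[x]) | x in r].
  apply/fintype.subsetP => z /setIP[/imsetP[x _ ->] /imsetP[y _ [<- e]]].
  by apply: imset_f; rewrite inE rootE !hornerE e subrr.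
apply: leq_ltn_trans (subset_leq_card sub) _.
apply: leq_ltn_trans (leq_imset_card _ _) _.
rewrite cardE; apply: leq_trans (max_poly_roots pq0 _ (enum_uniq _)) _.
  by apply/allP => x; rewrite mem_enum inE.
by rewrite (leq_trans (size_polyD _ _)) // size_polyN geq_max sp.
Qed.

(** The polynomials of degree at most 2 over a field with q elements give q^3
    sets of size q in a ground set of any size k >= q^2, pairwise meeting in at
    most 2 points. *)
Lemma quadratic_set_system (F : finFieldType) (k : nat) :
  (#|F| ^ 2 <= k)%N ->
  exists S : F * F * F -> {set 'I_k},
    (forall x, #|S x| = #|F|) /\
    (forall x y, x != y -> (#|S x :&: S y| <= 2)%N).
Proof.
rewrite -mulnn -card_prod => le_k.
pose h (j : F * F) : 'I_k := widen_ord le_k (enum_rank j).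
have h_inj : injective h.
  by move=> i j /(congr1 val) /= /val_inj /enum_rank_inj.
pose quad (x : F * F * F) : {poly F} := Poly [:: x.1.1; x.1.2; x.2].
have quad_inj : injective quad.
  move=> [[a b] c] [[a' b'] c'] /polyP e.
  by move: (e 0%N) (e 1%N) (e 2%N); rewrite !coef_Poly /= => -> -> ->.
exists (fun x => h @: poly_graph F (quad x)); split=> [x|x y xy].
  by rewrite card_imset // card_poly_graph.
rewrite -imsetI; last by move=> ? ? _ _; exact: h_inj.
rewrite card_imset //; apply: (@card_poly_graphI F 3).
- exact: size_Poly.
- exact: size_Poly.
- by rewrite inj_eq.
Qed.

(** * Kernels on finite sets *)

(** A finite subset of a Hausdorff space is discrete. *)
Lemma continuous_within_finite (T U : topologicalType) (A : set T)
    (f : T -> U) :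
  hausdorff_space T -> finite_set A -> {within A, continuous f}%classic.
Proof.
move=> hT fA; apply/subspace_continuousP => x Ax V /nbhs_singleton Vfx.
have cl : closed (A `\ x)%classic.
  move/hausdorff_accessible/accessible_finite_set_closed: hT; apply.
  exact: finite_setD.
have : nbhs x (~` (A `\ x))%classic.
  by apply: open_nbhs_nbhs; split; [rewrite openC | case=> _; apply].
apply: filterS => y /= nAy Ay.
by have [->//|xy] := EM (y = x); exfalso; apply: nAy.
Qed.

(** The real and the complex case share these three properties of the absolute
    value. *)
Section diagonal_kernel.
Variables (R : realType) (F : numFieldType) (abs : F -> R).
Hypotheses (abs_ge0 : forall x, 0 <= abs x).
Hypotheses (absN : forall x, abs (- x) = abs x).
Hypotheses (abs_nat : forall n : nat, abs n%:R = n%:R).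

Lemma supnorm_ge0 (T : Type) (A : set T) (f : T -> F) : 0 <= supnorm abs A f.
Proof.
rewrite /supnorm; set E := (X in sup X).
have [[s ubs]|/sup_out ->//] := EM (has_sup E).
have [_ [t At _]] := s.
by apply: le_trans (abs_ge0 (f t)) (ub_le_sup ubs _); exists t.
Qed.

Lemma supnorm_finite_ge (T : Type) (A : set T) (f : T -> F) (t : T) :
  finite_set A -> A t -> abs (f t) <= supnorm abs A f.
Proof.
move=> fA At; apply: ub_le_sup; last by exists t.
have /finite_seqP[s es] := finite_image (fun t => abs (f t)) fA.
exists (\sum_(y <- s) `|y|) => y; rewrite es /= => ys.
by rewrite (big_rem y) //= (le_trans (ler_norm y)) // lerDl sumr_ge0.
Qed.

Lemma supnorm_le (T : Type) (A : set T) (f : T -> F) (B : R) :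
  A !=set0%classic -> (forall t, A t -> abs (f t) <= B) ->
  supnorm abs A f <= B.
Proof.
move=> [t At] fB; apply: ge_sup; first by exists (abs (f t)), t.
by move=> _ [s As <-]; exact: fB.
Qed.

Lemma sigma_le (T : Type) (A : set T) (m : nat) (f : T -> F)
    (D : set (T -> F)) (c : 'I_m -> F) (g : 'I_m -> T -> F) :
  (forall i, D (g i)) ->
  sigma abs A m f D <= supnorm abs A (fun t => f t - \sum_(i < m) c i * g i t).
Proof.
move=> Dg; apply: ge_inf; last by exists c, g.
by exists 0 => _ [c' [g' [_ ->]]]; exact: supnorm_ge0.
Qed.

(** The finite set X as a set of points on the line. *)
Definition pt (X : finType) (x : X) : 'rV[R]_1 :=
  const_mx (nat_of_ord (enum_rank x))%:R.

Lemma pt_inj (X : finType) : injective (@pt X).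
Proof.
move=> x y /matrixP/(_ ord0 ord0); rewrite !mxE => /eqP.
by rewrite eqr_nat => /eqP/val_inj/enum_rank_inj.
Qed.

(** The inverse of [pt], with value x0 outside its range. *)
Definition unpt (X : finType) (x0 : X) (v : 'rV[R]_1) : X :=
  odflt x0 [pick x | pt X x == v].

Lemma ptK (X : finType) (x0 : X) : cancel (@pt X) (@unpt X x0).
Proof.
move=> x; rewrite /unpt.
by case: pickP => [y /eqP/pt_inj -> //|/(_ x)]; rewrite eqxx.
Qed.

Lemma finite_range_pt (X : finType) : finite_set (range (@pt X)).
Proof. exact/finite_image/finite_finset. Qed.

(** q times the identity matrix, as a kernel. *)
Definition diag_kernel (q : nat) (p : 'rV[R]_1 * 'rV[R]_1) : F :=
  if p.1 == p.2 then q%:R else 0.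

Lemma diag_kernel_continuous (X : finType) (q : nat) :
  Linfty (range (@pt X) `*` range (@pt X))%classic (diag_kernel q).
Proof.
apply: continuous_within_finite; first exact: norm_hausdorff.
by apply: finite_setX; exact: finite_range_pt.
Qed.

Lemma sigma_LK_diag_ge (X : finType) (m q : nat) :
  (m < #|X|)%N ->
  q%:R <= sigma abs (range (@pt X) `*` range (@pt X))%classic m
            (diag_kernel q) (LK_infty (range (@pt X)) (diag_kernel q)).
Proof.
move=> mX; set A := range (@pt X).
have /card_gt0P[x0 _] : (0 < #|X|)%N by exact: leq_ltn_trans mX.
apply: lb_le_inf.
  eexists; exists (fun=> 0), (fun _ p => 1 * diag_kernel q (pt X x0, p.2)).
  split; last reflexivity.
  move=> _; exists (pt X x0), (fun=> 1); split => //.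
    by exists x0.
  apply: continuous_within_finite; first exact: norm_hausdorff.
  exact: finite_range_pt.
move=> _ [c [g [Dg ->]]].
have /choice[z gz] : forall i, exists z : 'rV[R]_1, exists u : 'rV[R]_1 -> F,
    g i = fun p => u p.1 * diag_kernel q (z, p.2).
  by move=> i; have [z [u [_ _ e]]] := Dg i; exists z, u.
(* By counting, some point of A differs from the m centres z i. *)
have [x xz] : exists x : X, forall i, z i != pt X x.
  have /card_gt0P[x] : (0 < #|~: [set unpt X x0 (z i) | i in 'I_m]|)%N.
    rewrite cardsCs finset.setCK subn_gt0 (leq_ltn_trans _ mX) //.
    by rewrite (leq_trans (leq_imset_card _ _)) // card_ord.
  rewrite inE => xz; exists x => i; apply: contra xz => /eqP zi.
  by apply/imsetP; exists i; rewrite // zi ptK.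
have {1}-> : q%:R = abs (diag_kernel q (pt X x, pt X x) -
    \sum_(i < m) c i * g i (pt X x, pt X x)).
  rewrite big1 => [|i _]; first by rewrite subr0 /diag_kernel /= eqxx abs_nat.
  have [u ->] := gz i.
  by rewrite /diag_kernel /= (negbTE (xz i)) !mulr0.
apply: (@supnorm_finite_ge _ _
  (fun t => diag_kernel q t - \sum_(i < m) c i * g i t)).
  by apply: finite_setX; exact: finite_range_pt.
by split; exists x.
Qed.

Lemma sigma_Pi_diag_le (X : finType) (k q t : nat) (S : X -> {set 'I_k}) :
  (0 < #|X|)%N -> (forall x, #|S x| = q) ->
  (forall x y, x != y -> (#|S x :&: S y| <= t)%N) ->
  sigma abs (range (@pt X) `*` range (@pt X))%classic k
    (diag_kernel q) (Pi_infty (range (@pt X)) (range (@pt X))) <= t%:R.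
Proof.
move=> /card_gt0P[x0 _] cS cSI; set A := range (@pt X).
pose u (i : 'I_k) (v : 'rV[R]_1) : F := (i \in S (unpt X x0 v))%:R.
have cu i : Linfty A (u i).
  apply: continuous_within_finite; first exact: norm_hausdorff.
  exact: finite_range_pt.
apply: le_trans (@sigma_le _ _ k _ _ (fun=> 1)
  (fun i p => u i p.1 * u i p.2) _) _.
  by move=> i; exists (u i), (u i).
apply: supnorm_le; first by exists (pt X x0, pt X x0); split; exists x0.
move=> [_ _] [/= [x _ <-] [y _ <-]].
have -> : \sum_(i < k) 1 * (u i (pt X x) * u i (pt X y)) =
    #|S x :&: S y|%:R.
  rewrite -sum1_card natr_sum [RHS]big_mkcond; apply: eq_bigr => i _.
  by rewrite mul1r /u !ptK -natrM mulnb finset.in_setI; case: ifP.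
rewrite /diag_kernel /= (inj_eq (@pt_inj X)).
have [->|xy] := eqVneq x y.
  by rewrite finset.setIid cS subrr (abs_nat 0) ler0n.
by rewrite sub0r absN abs_nat ler_nat; exact: cSI.
Qed.

(** Any set system on more than m indices, with a ground set as large as the
    rank allowed to the bilinear approximants, bounds phi m from below. *)
Lemma LK_bound_set_system (theta : R) (phi : nat -> R) (m q t : nat)
    (X : finType) (S : X -> {set 'I_(Num.truncn (theta * (m.-1)%:R))}) :
  LK_bound abs theta phi -> 0 < phi m -> (0 < m < #|X|)%N ->
  (forall x, #|S x| = q) ->
  (forall x y, x != y -> (#|S x :&: S y| <= t)%N) ->
  q%:R <= phi m * t%:R.
Proof.
move=> H phi0 /andP[m0 mX] cS cSI.
have X0 : (0 < #|X|)%N by exact: leq_trans mX.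
have cA : compact (range (@pt X)) by exact/finite_compact/finite_range_pt.
have A0 : range (@pt X) !=set0%classic.
  by have /card_gt0P[x _] := X0; exists (pt X x), x.
apply: le_trans (sigma_LK_diag_ge X m q mX) _.
apply: le_trans (H m 1%N 1%N _ _ _ m0 cA A0 cA A0
  (diag_kernel_continuous X q)) _.
by rewrite ler_pM2l //; exact: sigma_Pi_diag_le cS cSI.
Qed.

(** * The order of the field in terms of the number of rows *)

Lemma LK_bound_large (theta : R) (phi : nat -> R) (m : nat) :
  LK_bound abs theta phi -> 1 / 4 <= theta -> 0 < phi m -> (4 ^ 6 < m)%N ->
  1 / 8 * Num.sqrt m%:R <= phi m.
Proof.
move=> H theta4 phi0 m_large.
have m1_gt0 : (0 < m.-1)%N by lia.
have /andP[lo hi] := @trunc_log_bounds 4 m.-1 isT m1_gt0.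
have n6 : (6 <= trunc_log 4 m.-1)%N by apply: trunc_log_max => //; lia.
case En : (trunc_log 4 m.-1) lo hi n6 => [//|n] lo hi n6.
(* The order of the field Fq is q = 2^n, with 4 q^2 <= m - 1 < 16 q^2. *)
have n_gt0 : (0 < n)%N by lia.
have [Fq _ cF] := @pPrimePowerField 2 n isT n_gt0.
have q2 : (#|Fq| ^ 2 = 4 ^ n)%N by rewrite cF -expnM mulnC expnM.
have q32 : (32 <= #|Fq|)%N by rewrite cF (@leq_exp2l 2 5 n).
move: lo hi; rewrite !expnS -q2 => lo hi.
have le_k : (#|Fq| ^ 2 <= Num.truncn (theta * (m.-1)%:R))%N.
  rewrite -[X in (X <= _)%N](@natrK R); apply: le_truncn.
  have : ((4 * #|Fq| ^ 2)%:R : R) <= (m.-1)%:R by rewrite ler_nat.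
  rewrite natrM => lo'.
  have : 1 / 4 * (m.-1)%:R <= theta * (m.-1)%:R by rewrite ler_wpM2r.
  lra.
have [S [cS cSI]] := @quadratic_set_system Fq _ le_k.
have mX : (0 < m < #|{: Fq * Fq * Fq}|)%N.
  have lt_q3 q : (32 <= q)%N -> (m.-1 < 4 * (4 * q ^ 2))%N -> (m < q * q * q)%N.
    by rewrite expnS expn1 => q32' hi'; nia.
  by rewrite !card_prod (leq_ltn_trans _ m_large) ?lt_q3.
have := @LK_bound_set_system theta phi m _ 2 _ S H phi0 mX cS cSI.
have : Num.sqrt (m%:R : R) <= 4 * #|Fq|%:R.
  rewrite -[leRHS]ger0_norm ?mulr_ge0 // -sqrtr_sqr ler_wsqrtr //.
  rewrite -natrM -natrX ler_nat expnMn.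
  by rewrite -(ltn_predK m_large) (leq_trans hi) // mulnA.
lra.
Qed.

Lemma sqrt_lower_bound (theta : R) (phi : nat -> R) :
  (forall m : nat, (0 < m)%N -> 0 < phi m) -> 1 / 4 <= theta ->
  LK_bound abs theta phi ->
  exists c : R, 0 < c /\
    forall m : nat, (0 < m)%N -> c * Num.sqrt m%:R <= phi m.
Proof.
move=> phi0 theta4 H.
have small M : exists c : R, 0 < c /\
    forall m : nat, (0 < m <= M)%N -> c * Num.sqrt m%:R <= phi m.
  elim: M => [|M [c [c0 IH]]]; first by exists 1; split => // -[].
  have s0 : 0 < Num.sqrt (M.+1%:R : R) by rewrite sqrtr_gt0 ltr0n.
  exists (Num.min c (phi M.+1 / Num.sqrt M.+1%:R)); split.
    by rewrite lt_min c0 divr_gt0 // phi0.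
  move=> m /andP[m0]; rewrite leq_eqVlt => /predU1P[->|mM].
    by rewrite -ler_pdivlMr // ge_min lexx orbT.
  apply: le_trans (IH m _); last by rewrite m0.
  by rewrite ler_wpM2r ?sqrtr_ge0 // ge_min lexx.
have [c [c0 cP]] := small (4 ^ 6)%N.
exists (Num.min c (1 / 8)); split; first by rewrite lt_min c0 divr_gt0.
move=> m m0; have [mM|mM] := leqP m (4 ^ 6)%N.
  apply: le_trans (cP m _); last by rewrite m0.
  by rewrite ler_wpM2r ?sqrtr_ge0 // ge_min lexx.
apply: le_trans (@LK_bound_large theta phi m H theta4 (phi0 m m0) mM).
by rewrite ler_wpM2r ?sqrtr_ge0 // ge_min lexx orbT.
Qed.

End diagonal_kernel.

Theorem proposition6p3 (R : realType) (b : R) (phi : nat -> R)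
    (hb : 1 < b <= 2)
    (hphi : forall m : nat, (0 < m)%N -> 0 < phi m) :
  (LK_bound (@real_abs R) (1 / b) phi ->
    exists c : R, 0 < c /\
      forall m : nat, (0 < m)%N -> c * Num.sqrt m%:R <= phi m) /\
  (LK_bound (@complex_abs R) (1 / (2 * b)) phi ->
    exists c : R, 0 < c /\
      forall m : nat, (0 < m)%N -> c * Num.sqrt m%:R <= phi m).
Proof.
move: hb => /andP[b1 b2]; have b0 : 0 < b by lra.
split; apply: sqrt_lower_bound => //.
- by move=> x; exact: normr_ge0.
- by move=> x; exact: normrN.
- by move=> n; exact: normr_nat.
- by rewrite ler_pdivlMr //; lra.
- by move=> x; rewrite /complex_abs normc_def /= sqrtr_ge0.
- by move=> x; rewrite /complex_abs normrN.
- by move=> n; rewrite /complex_abs normr_nat raddfMn.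
- by rewrite ler_pdivlMr ?mulr_gt0 //; lra.
Qed.
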